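(* Let $\Gamma$ be a distance-regular graph with valency $k\geq 3$, diameter $D\geq 2$, $a_1\neq 0$ and distinct eigenvalues $\theta_0>\theta_1>\cdots>\theta_D=-\frac{k}{a_1+1}$. If $c_2=(a_1+1)^2+1$ and $\Gamma$ contains an induced subgraph isomorphic to a generalized quadrangle $GQ(a_1+1,c_2-1)$, then $\theta_1=\frac{k-(a_1+1)(a_1+2)}{(a_1+1)^2}$ and $E_D$ is a light tail with associated minimal idempotent $E_1$.
   Context: A connected graph $\Gamma$ of diameter $D$ is distance-regular if there are integers $b_i,c_i$ ($0\le i\le D$) such that for any vertices $x,y$ at distance $i$, $y$ has exactly $c_i$ neighbours at distance $i-1$ from $x$ and $b_i$ neighbours at distance $i+1$ from $x$; $k=b_0$ and $a_i=k-b_i-c_i$. The eigenvalues are those of the adjacency matrix; $E_i$ denotes the orthogonal projection onto the $\theta_i$-eigenspace, with $E_0=\frac1n J$ ($n$ the number of vertices). A minimal idempotent $E$ is a light tail if $E\circ E=aE_0+bF$ (entrywise product) for some minimal idempotent $F\neq E_0$ and nonzero reals $a,b$; $F$ is the associated minimal idempotent. A generalized quadrangle $GQ(s,t)$ is a $K_{1,1,2}$-free distance-regular graph of diameter $2$ with intersection array $\{(t+1)s,ts;1,t+1\}$. *)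

(* Defs.v *)
From HB Require Import structures.
From mathcomp Require Import all_boot all_order all_algebra.
From mathcomp Require Import all_reals.
Set Implicit Arguments. Unset Strict Implicit. Unset Printing Implicit Defensive.
Import Order.TTheory GRing.Theory Num.Theory.

Section Graphs.
Variable T : finType.
Variable adj : rel T.

Fixpoint reach (n : nat) (x : T) : {set T} :=
  match n with
  | 0 => [set x]
  | m.+1 => reach m x :|: [set y | [exists z in reach m x, adj z y]]
  end.

Definition connected : Prop := forall x y : T, exists n, y \in reach n x.

(* graph distance: least n with y within n steps of x (|T| if unreachable,
   irrelevant for connected graphs) *)
Definition dist (x y : T) : nat := find (fun n => y \in reach n x) (iota 0 #|T|).

Definition is_drg (D : nat) (b c : nat -> nat) : Prop :=
  symmetric adj /\ irreflexive adj /\ connected /\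
  (exists x y, dist x y = D) /\ (forall x y, dist x y <= D) /\
  (forall x y,
     #|[set z | adj y z & dist x z == (dist x y).+1]| = b (dist x y) /\
     (0 < dist x y ->
        #|[set z | adj y z & dist x z == (dist x y).-1]| = c (dist x y))).

Definition K112_free : Prop :=
  forall w x y z : T, w != z -> adj x y -> adj w x -> adj w y ->
    adj z x -> adj z y -> adj w z.

Definition is_GQ (s t : nat) : Prop :=
  K112_free /\
  exists b c : nat -> nat, is_drg 2 b c /\
    [/\ b 0 = (t + 1) * s, b 1 = t * s, c 1 = 1 & c 2 = t + 1].

End Graphs.

Definition induced {T : finType} (adj : rel T) (S : {set T}) :
  rel {x : T | x \in S} := fun u v => adj (val u) (val v).

Definition a_ (b c : nat -> nat) (i : nat) : nat := b 0 - b i - c i.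

Local Open Scope ring_scope.

Definition adjmx (R : realType) (n : nat) (adj : rel 'I_n) : 'M[R]_n :=
  \matrix_(i, j) (adj i j)%:R.

Definition is_orth_proj (R : realType) (n : nat) (E V : 'M[R]_n) : Prop :=
  E^T = E /\ E *m E = E /\ (E == V)%MS.

Definition hadamard (R : realType) (n : nat) (E F : 'M[R]_n) : 'M[R]_n :=
  \matrix_(i, j) (E i j * F i j).

(* E is a light tail with associated minimal idempotent F (E0 = J/n) *)
Definition light_tail_with (R : realType) (n : nat) (E F E0 : 'M[R]_n) : Prop :=
  F != E0 /\ exists a b : R, a != 0 /\ b != 0 /\
    hadamard E E = a *: E0 + b *: F.
Arguments induced {T} adj S _ _.

(* Main.v *)
(* Write s = a_1 + 1 and let f be the vector supported on the quadrangle S that takes the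
   values s^2, -s, 1 at distance 0, 1, 2 from a point of S; it is an eigenvector of S for
   -(s^2 + 1) and is orthogonal to the constants. Every E_i is a polynomial in the
   adjacency matrix, so its entries depend on the distance only, and the recurrence for
   its entries at distance at most 2 shows that f^T E_i f is a positive multiple of
   (theta_i - k)(theta_i - theta'), with theta' = (k - s(s+1))/s^2. Since E_i is positive
   semidefinite, theta_i <= theta' for all i > 0. On the other hand f^T (E_D o E_D) f = 0,
   and E_D o E_D is positive semidefinite (Schur), so it kills f; hence E_D o E_D, a
   combination of the E_i, only involves those i with E_i f = 0, that is theta_i = k or
   theta_i = theta'. It is not a multiple of E_0, so theta' is an eigenvalue, namely theta_1. *)

Require Import Defs.
From HB Require Import structures.
From mathcomp Require Import all_boot all_order all_algebra.
From mathcomp Require Import all_reals.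
From mathcomp Require Import ring zify.
Import Order.TTheory GRing.Theory Num.Theory.
Local Open Scope ring_scope.

(** * Distances and intersection numbers *)

Section Distance.
Local Open Scope nat_scope.
Context (T : finType) (adj : rel T).
Implicit Types x y z : T.

Lemma reach_step n x y z : y \in reach adj n x -> adj y z -> z \in reach adj n.+1 x.
Proof.
by move=> yn yz /=; rewrite !inE; apply/orP; right; apply/existsP; exists y; rewrite yn.
Qed.

Lemma reachS_sub n x : reach adj n x \subset reach adj n.+1 x.
Proof. exact: subsetUl. Qed.

Lemma reach_mono m n x : m <= n -> reach adj m x \subset reach adj n x.
Proof.
elim: n => [|n IHn]; first by rewrite leqn0 => /eqP ->.
rewrite leq_eqVlt => /predU1P[-> //|]; rewrite ltnS => /IHn smn.
exact: subset_trans smn (reachS_sub n x).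
Qed.

Lemma reach_stable m n x : reach adj n.+1 x = reach adj n x ->
  reach adj (n + m) x = reach adj n x.
Proof. by move=> st; elim: m => [|m IHm]; rewrite ?addn0 // addnS /= IHm. Qed.

(** The search in [dist] stays below [#|T|], so the balls must stop growing before that: strict
    growth at every such step would give more than [#|T|] vertices. *)
Lemma reach_stabilizes x : exists2 n, n < #|T| & reach adj n.+1 x = reach adj n x.
Proof.
have [n st|nst] := pickP (fun n : 'I_#|T| => reach adj n.+1 x == reach adj n x).
  by exists n => //; apply/eqP.
have grow n : n <= #|T| -> n < #|reach adj n x|.
  elim: n => [|n IHn] lenT; first by rewrite /= cards1.
  apply: leq_ltn_trans (IHn (ltnW lenT)) _; apply: proper_card.
  rewrite properEneq reachS_sub andbT eq_sym.
  by have /= := nst (Ordinal lenT) => ->.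
by have := leq_trans (grow _ (leqnn _)) (max_card _); rewrite ltnn.
Qed.

Lemma dist_le n x y : y \in reach adj n x -> dist adj x y <= n.
Proof.
move=> yn; rewrite leqNgt; apply/negP => lt_n.
have lt_nT : n < #|T|.
  by apply: leq_trans lt_n _; rewrite -[leqRHS](size_iota 0); apply: find_size.
by have := before_find 0 lt_n; rewrite nth_iota // add0n yn.
Qed.

Lemma dist_xx x : dist adj x x = 0.
Proof. by apply/eqP; rewrite -leqn0; apply: dist_le; rewrite /= inE. Qed.

Hypothesis conn : connected adj.

(** By stabilization, a vertex reached at all is reached in fewer than [#|T|] steps, so on a
    connected graph the search never returns its default value. *)
Lemma mem_reach_dist x y : y \in reach adj (dist adj x y) x.
Proof.
have [n lt_nT st] := reach_stabilizes x; have [m ym] := conn x y.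
have yn : y \in reach adj n x.
  have [le_mn|lt_nm] := leqP m n; first exact: (subsetP (reach_mono _ _ _ le_mn)).
  by move: ym; rewrite -(subnKC (ltnW lt_nm)) reach_stable.
have has_y : has (fun i => y \in reach adj i x) (iota 0 #|T|).
  by apply/hasP; exists n; rewrite ?mem_iota.
have := nth_find 0 has_y; rewrite nth_iota //.
by rewrite -[ltnRHS](size_iota 0) -has_find.
Qed.

Lemma dist_leE n x y : (dist adj x y <= n) = (y \in reach adj n x).
Proof.
apply/idP/idP => [le_n|]; last exact: dist_le.
exact: (subsetP (reach_mono _ _ _ le_n)) (mem_reach_dist x y).
Qed.

Lemma dist_eq0 x y : (dist adj x y == 0) = (x == y).
Proof. by rewrite -leqn0 dist_leE /= inE eq_sym. Qed.

Lemma dist_adj x y z : adj y z -> dist adj x z <= (dist adj x y).+1.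
Proof. by move=> yz; rewrite dist_leE (reach_step _ _ _ _ (mem_reach_dist x y)). Qed.

Lemma dist_pred x y n : dist adj x y = n.+1 ->
  exists2 z, adj z y & dist adj x z = n.
Proof.
move=> dxy; have := mem_reach_dist x y; rewrite dxy /= !inE -dist_leE dxy ltnn /=.
case/existsP=> z /andP[zn zy]; exists z => //.
apply/eqP; rewrite eqn_leq dist_leE zn -ltnS -dxy; exact: dist_adj.
Qed.

Lemma dist_interval x y n : n <= dist adj x y -> exists z, dist adj x z = n.
Proof.
move: {2}(dist adj x y) (erefl (dist adj x y)) => m.
elim: m y => [|m IHm] y dxy; rewrite dxy.
  by rewrite leqn0 => /eqP ->; exists y.
rewrite leq_eqVlt => /predU1P[->|]; first by exists y.
by rewrite ltnS; have [z _ dxz] := dist_pred _ _ _ dxy; have := IHm z dxz; rewrite dxz.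
Qed.

Hypothesis adj_irr : irreflexive adj.

Lemma dist_eq1 x y : (dist adj x y == 1) = adj x y.
Proof.
apply/eqP/idP => [/dist_pred[z zy /eqP]|xy]; first by rewrite dist_eq0 => /eqP ->.
have := dist_adj x x y xy; rewrite dist_xx leq_eqVlt => /predU1P[//|].
by rewrite ltnS leqn0 dist_eq0 => /eqP xy0; move: xy; rewrite xy0 adj_irr.
Qed.

Lemma dist_eq2 x y z : adj x z -> adj z y -> x != y -> ~~ adj x y -> dist adj x y = 2.
Proof.
move=> xz zy; rewrite -dist_eq0 -dist_eq1.
have := dist_adj x z y zy; have /eqP -> : dist adj x z == 1 by rewrite dist_eq1.
by case: (dist adj x y) => [|[|[|]]].
Qed.

End Distance.

(** * Consequences of the intersection array *)

Section DistanceRegular.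
Local Open Scope nat_scope.
Context (T : finType) (adj : rel T) (D : nat) (b c : nat -> nat).
Hypothesis drg : is_drg adj D b c.
Implicit Types x y z : T.

(* The number of neighbours of y at distance i from x, when y is at distance j from x. *)
Definition intersection_number (i j : nat) : nat :=
  if i == j.+1 then b j else if i.+1 == j then c j
  else if i == j then b 0 - b j - (if j is 0 then 0 else c j) else 0.

Lemma drg_sym : symmetric adj. Proof. by case: drg. Qed.
Lemma drg_irr : irreflexive adj. Proof. by case: drg => _ []. Qed.
Lemma drg_conn : connected adj. Proof. by case: drg => _ [_ []]. Qed.
Lemma drg_dist_le x y : dist adj x y <= D.
Proof. by case: drg => _ [_ [_ [_ []]]]. Qed.

Lemma drg_b x y :
  #|[set z | adj y z & dist adj x z == (dist adj x y).+1]| = b (dist adj x y).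
Proof. by case: drg => _ [_ [_ [_ [_ /(_ x y)[]]]]]. Qed.

Lemma drg_c x y : 0 < dist adj x y ->
  #|[set z | adj y z & dist adj x z == (dist adj x y).-1]| = c (dist adj x y).
Proof. by case: drg => _ [_ [_ [_ [_ /(_ x y)[]]]]]. Qed.

Lemma drg_ex_dist i : i <= D -> exists x y, dist adj x y = i.
Proof.
case: drg => _ [_ [_ [[x [y <-]] _]]] /(dist_interval _ _ drg_conn)[z].
by exists x, z.
Qed.

Lemma drg_valency y : #|[set z | adj y z]| = b 0.
Proof.
rewrite -(dist_xx _ adj y) -drg_b dist_xx; apply: eq_card => z; rewrite !inE.
by rewrite dist_eq1 ?andbb //; [exact: drg_conn | exact: drg_irr].
Qed.

(** A vertex at distance [i.+1] from [x] is itself counted by [b i] at its predecessor on a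
    geodesic. *)
Lemma drg_b_gt0 i : i < D -> 0 < b i.
Proof.
move=> ltiD; have [x [y dxy]] := drg_ex_dist _ ltiD.
have [z zy dxz] := dist_pred _ _ drg_conn _ _ _ dxy.
by rewrite -dxz -drg_b; apply/card_gt0P; exists y; rewrite inE zy dxy dxz eqxx.
Qed.

Lemma drg_bD : b D = 0.
Proof.
have [x [y dxy]] := drg_ex_dist _ (leqnn D).
rewrite -dxy -drg_b dxy; apply/eqP; rewrite cards_eq0; apply/eqP/setP=> z.
by rewrite !inE; have := drg_dist_le x z; lia.
Qed.

Lemma drg_c1 : 0 < D -> c 1 = 1.
Proof.
move=> D0; have [x [y dxy]] := drg_ex_dist _ D0.
have := drg_c x y; rewrite dxy => <- //=; rewrite -(cards1 x).
apply: eq_card => z; rewrite !inE dist_eq0; last exact: drg_conn.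
have [<-|] := eqVneq x z; last by rewrite andbF.
by rewrite andbT drg_sym -dist_eq1 ?dxy //; [exact: drg_conn | exact: drg_irr].
Qed.

Lemma dist_neighbor x y z : adj y z ->
  [|| dist adj x z == (dist adj x y).+1, (dist adj x z).+1 == dist adj x y
    | dist adj x z == dist adj x y].
Proof.
move=> yz; have := dist_adj _ _ drg_conn x y z yz; rewrite drg_sym in yz.
have := dist_adj _ _ drg_conn x z y yz; lia.
Qed.

Lemma drg_count i x y :
  #|[set z | adj y z & dist adj x z == i]| = intersection_number i (dist adj x y).
Proof.
set j := dist adj x y; rewrite /intersection_number.
(* The definition leaves [c 0] unconstrained, so [j = 0] is treated apart: no distance lies below
   it. *)
have below : #|[set z | adj y z & (dist adj x z).+1 == j]| =
    if j is 0 then 0 else c j.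
  case: (posnP j) => [->|j0].
    by apply/eqP; rewrite cards_eq0; apply/eqP/setP=> z; rewrite !inE andbF.
  rewrite -[j in if j is _.+1 then _ else _](prednK j0) -(drg_c x y) //.
  by apply: eq_card => z; rewrite !inE; congr (_ && _); lia.
case: eqP => [->|ne1]; first exact: drg_b.
case: eqP => [ij|ne2].
  by move: below; rewrite -ij => <-; apply: eq_card => z; rewrite !inE.
case: eqP => [->|ne3]; last first.
  apply/eqP; rewrite cards_eq0; apply/eqP/setP=> z; rewrite !inE.
  by apply/negP=> /andP[/(dist_neighbor x)]; rewrite -/j; lia.
(* For [i = j] the count is what remains of the valency once the neighbours at distances [j.+1] and
   [j.-1] are removed. *)
rewrite -below -(drg_b x y) -/j -(drg_valency y).
have /(congr1 (fun A : {set T} => #|A|)) :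
    [set z | adj y z] = [set z | adj y z & dist adj x z == j.+1] :|:
      ([set z | adj y z & (dist adj x z).+1 == j] :|:
       [set z | adj y z & dist adj x z == j]).
  apply/setP=> z; rewrite !inE -!andb_orr; apply/idP/idP => [yz|/andP[]//].
  by rewrite yz /=; apply: dist_neighbor.
have disj (A B : {set T}) : A :&: B = set0 -> #|A :|: B| = #|A| + #|B|.
  by move=> AB; rewrite cardsU AB cards0 subn0.
rewrite disj; last by apply/setP=> z; rewrite !inE; lia.
rewrite disj; last by apply/setP=> z; rewrite !inE; lia.
lia.
Qed.

(** The neighbours counted by [b j] and by [c j] form disjoint sets; this makes the truncated
    subtraction in [a_] a genuine one. *)
Lemma drg_bc_le j : 0 < j <= D -> b j + c j <= b 0.
Proof.
case/andP=> j0 /drg_ex_dist[x [y dxy]].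
rewrite -(drg_valency y); have := drg_b x y; have := drg_c x y; rewrite dxy => <- // <-.
set A := [set z | _ & _]; set B := [set z | _ & _].
have AB : B :&: A = set0 by apply/setP=> z; rewrite !inE; lia.
rewrite addnC -cardsUI AB cards0 addn0.
by apply/subset_leq_card/subsetP=> z; rewrite !inE; lia.
Qed.

End DistanceRegular.

Section NeighborSums.
Context (R : realType) (T : finType) (adj : rel T) (D : nat) (b c : nat -> nat).
Hypothesis drg : is_drg adj D b c.

(** Neighbours are grouped by their distance from [x]. This serves both the quadrangle and the
    Bose-Mesner algebra of the whole graph. *)
Lemma sum_neighbors (h : nat -> R) x y :
  \sum_(z | adj y z) h (dist adj x z) =
  \sum_(i < D.+1) h i * (intersection_number b c i (dist adj x y))%:R.
Proof.
have lt_d z : (dist adj x z < D.+1)%N by rewrite ltnS (drg_dist_le _ _ _ _ _ drg).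
rewrite (partition_big (fun z => inord (dist adj x z) : 'I_D.+1) xpredT) //=.
apply: eq_bigr => i _; rewrite -(drg_count _ _ _ _ _ drg).
rewrite -sum1_card natr_sum mulr_sumr.
have same z : (inord (dist adj x z) == i) = (dist adj x z == i :> nat).
  by rewrite -val_eqE /= inordK.
apply: eq_big => [z|z]; first by rewrite inE same.
by rewrite same mulr1 => /andP[_ /eqP ->].
Qed.

End NeighborSums.

(** * The eigenvector of a generalized quadrangle *)

Section QuadrangleVector.
Context (R : realType) (n : nat) (adj : rel 'I_n).
Hypotheses (conn : connected adj) (irr : irreflexive adj).

(** Distances may be longer in an induced subgraph, but a common neighbour and non-adjacency both
    carry over, which settles distance 2. *)
Lemma dist_induced2 (S : {set 'I_n}) (u v : {x | x \in S}) :
  connected (induced adj S) ->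
  dist (induced adj S) u v = 2 -> dist adj (val u) (val v) = 2.
Proof.
move=> conn' d2; have irr' : irreflexive (induced adj S) by move=> w; apply: irr.
have [w wv /eqP] := dist_pred _ _ conn' _ _ _ d2.
rewrite dist_eq1 // => uw; apply: (dist_eq2 _ _ conn irr _ _ (val w)) => //.
  by rewrite (inj_eq val_inj) -(dist_eq0 _ _ conn') d2.
by have := dist_eq1 _ _ conn' irr' u v; rewrite d2 => /esym/negbT.
Qed.

(* The vector is supported on the quadrangle and takes the values s^2, -s, 1 at
   distance 0, 1, 2 from a base point: it is an eigenvector of the quadrangle for
   its least eigenvalue -(t+1). *)
Lemma GQ_vector (S : {set 'I_n}) (s t : nat) :
  (0 < s)%N -> is_GQ (induced adj S) s t ->
  exists2 f : 'cV[R]_n, 0 < (f^T *m f) 0 0 &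
    forall (M : 'M[R]_n) (m0 m1 m2 : R), (forall x, M x x = m0) ->
      (forall x y, dist adj x y = 1 -> M x y = m1) ->
      (forall x y, dist adj x y = 2 -> M x y = m2) ->
      (f^T *m M *m f) 0 0 =
      (m0 - m2 - (t.+1)%:R * (m1 - m2)) * (f^T *m f) 0 0.
Proof.
move=> s0 [_ [b [c [drg [b0 b1 c1 c2]]]]].
set adj' := induced adj S in drg.
have conn' := drg_conn _ _ _ _ _ drg; have irr' := drg_irr _ _ _ _ _ drg.
have b2 := drg_bD _ _ _ _ _ drg.
have [u0 _] : exists u v, dist adj' u v = 0 by apply: drg_ex_dist drg _ _.
pose h i : R := nth 0 [:: s%:R ^+ 2; - s%:R; 1] i.
pose g u := h (dist adj' u0 u).
have s1 : s = s.-1.+1 by rewrite prednK.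
have g_eigen u : \sum_(v | adj' u v) g v = - t.+1%:R * g u.
  rewrite (sum_neighbors _ _ _ _ _ _ drg) !big_ord_recr big_ord0 /= add0r /g /h.
  have := drg_dist_le _ _ _ _ _ drg u0 u.
  move: (dist adj' u0 u) => [|[|[|//]]] _; rewrite /intersection_number /=.
  - rewrite b0 subnn sub0n; rewrite -[t.+1]addn1; ring.
  - rewrite c1 b0 b1 (_ : _ - _ - _ = s.-1)%N; last by rewrite s1; lia.
    by rewrite s1 /=; ring.
  - rewrite c2 b0 b2 (_ : _ - _ - _ = (t + 1) * s.-1)%N; last by rewrite s1; lia.
    by rewrite s1 /=; ring.
have adj'_sym := drg_sym _ _ _ _ _ drg.
(* Summing the eigenvalue equation over all points multiplies the total by the valency [(t + 1) * s]
   as well as by [-(t + 1)], so the total is zero. *)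
have g_sum : \sum_u g u = 0.
  have : \sum_u \sum_(v | adj' u v) g v = ((t + 1) * s)%:R * \sum_u g u.
    rewrite (exchange_big_dep xpredT) //= mulr_sumr; apply: eq_bigr => v _.
    rewrite sumr_const -b0 -(drg_valency _ _ _ _ _ drg v) mulr_natl.
    by congr (_ *+ _); apply: eq_card => u; rewrite !inE adj'_sym.
  rewrite (eq_bigr _ (fun u _ => g_eigen u)) -mulr_sumr => /eqP.
  rewrite -subr_eq0 -mulrBl mulf_eq0 => /orP[|/eqP //].
  rewrite -opprD oppr_eq0 -natrD pnatr_eq0; lia.
pose f : 'cV[R]_n := \sum_u g u *: delta_mx (val u) 0.
have fT : f^T = \sum_u g u *: delta_mx 0 (val u).
  by rewrite /f raddf_sum; apply: eq_bigr => u _ /=; rewrite linearZ /= trmx_delta.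
have fMf M : (f^T *m M *m f) 0 0 = \sum_u g u * \sum_v g v * M (val u) (val v).
  rewrite fT /f 2!mulmx_suml summxE; apply: eq_bigr => u _.
  rewrite mulmx_sumr summxE mulr_sumr; apply: eq_bigr => v _.
  rewrite -!scalemxAl -scalemxAr 2!mxE -rowE -colE !mxE.
  by rewrite mulrA.
have fMf2 (M : 'M[R]_n) (m0 m1 m2 : R) : (forall x, M x x = m0) ->
      (forall x y, dist adj x y = 1 -> M x y = m1) ->
      (forall x y, dist adj x y = 2 -> M x y = m2) ->
    (f^T *m M *m f) 0 0 = (m0 - m2 - (t.+1)%:R * (m1 - m2)) * \sum_u g u ^+ 2.
  move=> M0 M1 M2; rewrite fMf mulr_sumr; apply: eq_bigr => u _.
  (* On [S] the matrix is [(m0 - m2) I + (m1 - m2) A' + m2 J], with [A'] the adjacency matrix of the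
     quadrangle; [J] kills [g] because its total is zero. *)
  have Muv v : g v * M (val u) (val v) =
      (if v == u then (m0 - m2) * g v else 0) +
      (if adj' u v then (m1 - m2) * g v else 0) + m2 * g v.
    have := drg_dist_le _ _ _ _ _ drg u v; case d: dist => [|[|[|//]]] _.
    - move/eqP: d; rewrite dist_eq0 // => /eqP <-; rewrite eqxx irr' M0; ring.
    - have uv : adj' u v by rewrite -(dist_eq1 _ _ conn' irr') d.
      rewrite uv eq_sym -(dist_eq0 _ _ conn') d /= M1; first by ring.
      by apply/eqP; rewrite dist_eq1.
    - rewrite -(dist_eq1 _ _ conn' irr') eq_sym -(dist_eq0 _ _ conn') d /= M2.
        by ring.
      exact: dist_induced2.
  under eq_bigr do rewrite Muv.
  rewrite !big_split -!big_mkcond /= big_pred1_eq -!mulr_sumr g_sum g_eigen.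
  ring.
(* The norm is the case of the identity matrix, with values 1, 0, 0. *)
have ff : (f^T *m f) 0 0 = \sum_u g u ^+ 2.
  rewrite -[in LHS](mulmx1 f^T) (fMf2 _ 1 0 0) => [|x|x y xy|x y xy].
  - by ring.
  - by rewrite mxE eqxx.
  - by rewrite mxE -(dist_eq0 _ _ conn) xy.
  - by rewrite mxE -(dist_eq0 _ _ conn) xy.
exists f; rewrite ff; last exact: fMf2.
rewrite (bigD1 u0) //= ltr_pwDl ?sumr_ge0 // => [|u _]; last exact: sqr_ge0.
by rewrite /g dist_xx /h /= !exprn_gt0 // ltr0n.
Qed.

End QuadrangleVector.

(** * Eigenprojections and the Bose-Mesner algebra *)

Section EigenProjections.
Context (R : realType) (n D : nat) (A : 'M[R]_n.+1) (theta : nat -> R)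
  (E : nat -> 'M[R]_n.+1).
Hypotheses (A_sym : A^T = A)
  (theta_dec : forall i j, (i < j <= D)%N -> theta j < theta i)
  (E_proj : forall i, (i <= D)%N -> is_orth_proj (E i) (eigenspace A (theta i))).

Lemma horner_mx_eigen m (B : 'M[R]_(n.+1, m)) x p :
  A *m B = x *: B -> horner_mx A p *m B = p.[x] *: B.
Proof.
move=> AB; elim/poly_ind: p => [|p a IHp]; first by rewrite rmorph0 mul0mx horner0 scale0r.
rewrite rmorphD rmorphM /= horner_mx_X horner_mx_C hornerMXaddC mulmxDl -mulmxA AB.
by rewrite -scalemxAr IHp mul_scalar_mx scalerA scalerDl mulrC.
Qed.

Lemma proj_tr i : (i <= D)%N -> (E i)^T = E i.
Proof. by case/E_proj. Qed.

Lemma proj_idem i : (i <= D)%N -> E i *m E i = E i.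
Proof. by case/E_proj => _ []. Qed.

Lemma proj_mulA i : (i <= D)%N -> E i *m A = theta i *: E i.
Proof. by case/E_proj => _ [_ /andP[sE _]]; apply/eigenspaceP. Qed.

Lemma proj_Amul i : (i <= D)%N -> A *m E i = theta i *: E i.
Proof.
by move=> iD; rewrite -{1}A_sym -(proj_tr _ iD) -trmx_mul proj_mulA // linearZ.
Qed.

(** The rows of [W] lie in the row space of [E i], so [W = B *m E i] and idempotence applies. *)
Lemma proj_fix i m (W : 'M[R]_(m, n.+1)) : (i <= D)%N ->
  W *m A = theta i *: W -> W *m E i = W.
Proof.
move=> iD /eigenspaceP WA; have [_ [EE /andP[_ sE]]] := E_proj _ iD.
by have /submxP[B ->] := submx_trans WA sE; rewrite -mulmxA EE.
Qed.

Lemma theta_neq i j : (i <= D)%N -> (j <= D)%N -> i != j -> theta i != theta j.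
Proof.
move=> iD jD; rewrite neq_ltn => /orP[] lt_ij.
  by rewrite gt_eqF // theta_dec // lt_ij.
by rewrite lt_eqF // theta_dec // lt_ij.
Qed.

(** Evaluating [E i *m A *m E j] from either side gives both eigenvalues as factors. *)
Lemma proj_ortho i j : (i <= D)%N -> (j <= D)%N -> i != j -> E i *m E j = 0.
Proof.
move=> iD jD /(theta_neq _ _ iD jD) ne_ij.
have /eqP : (theta i - theta j) *: (E i *m E j) = 0.
  by rewrite scalerBl scalemxAl -proj_mulA // scalemxAr -proj_Amul // mulmxA subrr.
by rewrite scaler_eq0 subr_eq0 (negPf ne_ij) => /eqP.
Qed.

Hypothesis A_min : horner_mx A (\prod_(i < D.+1) ('X - (theta i)%:P)) = 0.

(* Peel the factors of A_min off one at a time: if W p(A) (A - theta_k) = 0, then W p(A)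
   is fixed by E_k, but W p(A) E_k is a multiple of W E_k = 0. *)
Lemma proj_separate (W : 'M[R]_n.+1) :
  (forall i, (i <= D)%N -> W *m E i = 0) -> W = 0.
Proof.
move=> WE; have : W *m horner_mx A (\prod_(i < D.+1) ('X - (theta i)%:P)) = 0.
  by rewrite A_min mulmx0.
elim: {-2}D.+1 (leqnn D.+1) => [|k IHk] kD.
  by rewrite big_ord0 rmorph1 mulmx1.
rewrite big_ord_recr /=; set p := \prod_(i < k) _ => Wp; apply: IHk; first exact: ltnW.
have WpA : W *m horner_mx A p *m A = theta k *: (W *m horner_mx A p).
  apply/eqP; rewrite -subr_eq0 -mul_mx_scalar -mulmxBr -mulmxA; apply/eqP.
  by rewrite -[RHS]Wp rmorphM rmorphB /= horner_mx_X horner_mx_C.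
rewrite -(proj_fix k _ _ kD WpA) -mulmxA (horner_mx_eigen _ _ (theta k)) ?proj_Amul //.
by rewrite -scalemxAr WE ?scaler0.
Qed.

(** Lagrange interpolation: [q] vanishes at every eigenvalue except [theta i], and the two sides are
    compared after multiplication by each [E j]. *)
Lemma proj_horner i : (i <= D)%N -> exists p, E i = horner_mx A p.
Proof.
move=> iD; pose q := \prod_(j < D.+1 | j != i :> nat) ('X - (theta j)%:P).
exists (q.[theta i]^-1 *: q); apply/eqP; rewrite -subr_eq0; apply/eqP/proj_separate.
move=> j jD; rewrite mulmxBl (horner_mx_eigen _ _ (theta j)) ?proj_Amul // hornerZ.
have [<-|ne_ij] := eqVneq i j.
  rewrite proj_idem // mulVf ?scale1r ?subrr // horner_prod.
  apply/prodf_neq0 => k ne_ki; rewrite hornerXsubC subr_eq0 theta_neq // 1?eq_sym //.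
  by rewrite -ltnS.
have -> : q.[theta j] = 0.
  rewrite /q (bigD1 (Ordinal (jD : (j < D.+1)%N))) 1?eq_sym //=.
  by rewrite hornerM hornerXsubC subrr mul0r.
by rewrite proj_ortho // mulr0 scale0r subrr.
Qed.

End EigenProjections.

(** * The Bose-Mesner algebra and the intersection matrix *)

Section BoseMesner.
Context (R : realType) (n : nat) (adj : rel 'I_n.+1) (D : nat) (b c : nat -> nat).
Hypothesis drg : is_drg adj D b c.
Notation A := (adjmx R adj).

(** The row [m] holds the coordinates in the basis of distance matrices; as distances are at most
    [D], [inord] never takes its default value. *)
Definition bose_mesner (m : 'rV[R]_D.+1) : 'M[R]_n.+1 :=
  \matrix_(x, y) m 0 (inord (dist adj x y)).

(** This represents right multiplication by [A] in these coordinates, so its characteristic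
    polynomial, of degree [D.+1], annihilates [A]. *)
Definition intersection_mx : 'M[R]_D.+1 :=
  \matrix_(i, j) (intersection_number b c i j)%:R.
Notation L := intersection_mx.

Lemma adjmx_sym : A^T = A.
Proof. by apply/matrixP => x y; rewrite !mxE (drg_sym _ _ _ _ _ drg). Qed.

Lemma bose_mesnerE m x y i : dist adj x y = i -> bose_mesner m x y = m 0 (inord i).
Proof. by rewrite mxE => ->. Qed.

Lemma bose_mesner_inj : injective bose_mesner.
Proof.
move=> m m' eq_mm'; apply/rowP => i; have lt_iD := ltn_ord i; rewrite ltnS in lt_iD.
have [x [y dxy]] := drg_ex_dist _ _ _ _ _ drg _ lt_iD.
by rewrite -[i]inord_val -dxy; have /matrixP/(_ x y) := eq_mm'; rewrite !mxE.
Qed.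

Lemma bose_mesner1 : bose_mesner (delta_mx 0 0) = 1%:M.
Proof.
apply/matrixP => x y; rewrite !mxE /= -(dist_eq0 _ _ (drg_conn _ _ _ _ _ drg)).
by rewrite -val_eqE /= inordK // ltnS (drg_dist_le _ _ _ _ _ drg).
Qed.

Lemma bose_mesner0 : bose_mesner 0 = 0.
Proof. by apply/matrixP => x y; rewrite !mxE. Qed.

Lemma bose_mesnerD m m' : bose_mesner (m + m') = bose_mesner m + bose_mesner m'.
Proof. by apply/matrixP => x y; rewrite !mxE. Qed.

Lemma bose_mesnerZ a m : bose_mesner (a *: m) = a *: bose_mesner m.
Proof. by apply/matrixP => x y; rewrite !mxE. Qed.

Lemma bose_mesner_adj m : bose_mesner m *m A = bose_mesner (m *m L).
Proof.
apply/matrixP => x y; rewrite !mxE.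
transitivity (\sum_(z | adj y z) m 0 (inord (dist adj x z))).
  rewrite [RHS]big_mkcond; apply: eq_bigr => z _.
  by rewrite !mxE (drg_sym _ _ _ _ _ drg); case: ifP; rewrite ?mulr1 ?mulr0.
rewrite (sum_neighbors _ _ _ _ _ _ drg (fun i => m 0 (inord i))).
apply: eq_bigr => i _; rewrite mxE inord_val inordK //.
by rewrite ltnS (drg_dist_le _ _ _ _ _ drg).
Qed.

Lemma bose_mesner_horner m p :
  bose_mesner m *m horner_mx A p = bose_mesner (m *m horner_mx L p).
Proof.
elim/poly_ind: p => [|p a IHp].
  by rewrite !rmorph0 !mulmx0 bose_mesner0.
rewrite !rmorphD !rmorphM /= !horner_mx_X !horner_mx_C !mulmxDr !mul_mx_scalar.
by rewrite bose_mesnerD bose_mesnerZ !mulmxA IHp bose_mesner_adj.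
Qed.

Lemma horner_adjmx p : exists m, horner_mx A p = bose_mesner m.
Proof.
by exists (delta_mx 0 0 *m horner_mx L p); rewrite -bose_mesner_horner bose_mesner1 mul1mx.
Qed.

Lemma bose_mesner_eigen m x : bose_mesner m *m A = x *: bose_mesner m ->
  forall j : 'I_D.+1, \sum_(i < D.+1) m 0 i * (intersection_number b c i j)%:R = x * m 0 j.
Proof.
rewrite bose_mesner_adj -bose_mesnerZ => /bose_mesner_inj/rowP mL j.
by have := mL j; rewrite !mxE => <-; apply: eq_bigr => i _; rewrite mxE.
Qed.

(** In column [i] of the recurrence the entry at distance [i.+1] has coefficient [b i], which is
    nonzero, so the diagonal determines all entries. Hence eigenmatrices with the same eigenvalue
    are proportional. *)
Lemma bose_mesner_eigen0 m x : bose_mesner m *m A = x *: bose_mesner m ->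
  m 0 0 = 0 -> m = 0.
Proof.
move=> /bose_mesner_eigen mA m0.
suff mi i : forall j : 'I_D.+1, (j <= i)%N -> m 0 j = 0.
  by apply/rowP => j; rewrite mxE; apply: (mi j).
elim: i => [|i IHi] j.
  by rewrite leqn0 => /eqP j0; rewrite -m0; congr (m 0 _); apply: val_inj.
rewrite leq_eqVlt ltnS => /predU1P[ji|]; last exact: IHi.
have lt_iD : (i < D.+1)%N by rewrite -ltnS -ji (leq_trans (ltn_ord j)).
have := mA (Ordinal lt_iD); rewrite (IHi (Ordinal lt_iD)) // mulr0 (bigD1 j) //= big1.
  rewrite addr0 /intersection_number ji eqxx => /eqP; rewrite mulf_eq0 pnatr_eq0.
  have /gtn_eqF -> : (0 < b i)%N.
    by apply: (drg_b_gt0 _ _ _ _ _ drg); rewrite -ltnS -ji.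
  by rewrite orbF => /eqP.
move=> l ne_lj; have [/IHi -> | lt_il] := leqP l i; first by rewrite mul0r.
rewrite /intersection_number; move: ne_lj; rewrite -val_eqE /= ji => /negPf ->.
by rewrite !ifF ?mulr0 //; lia.
Qed.

Lemma bose_mesner_hadamard m m' :
  hadamard (bose_mesner m) (bose_mesner m') = bose_mesner (\row_i (m 0 i * m' 0 i)).
Proof. by apply/matrixP => x y; rewrite !mxE. Qed.

Section Spectrum.
Variable theta : nat -> R.
Hypotheses
  (theta_dec : forall i j, (i < j <= D)%N -> theta j < theta i)
  (theta_eig : forall i, (i <= D)%N -> eigenvalue A (theta i)).

(* Every theta i is a root of the characteristic polynomial of L, which annihilates A
   by Cayley-Hamilton and has degree D + 1, so there is no room for other factors. *)
Lemma adjmx_annihilated : horner_mx A (\prod_(i < D.+1) ('X - (theta i)%:P)) = 0.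
Proof.
have LA : horner_mx A (char_poly L) = 0.
  by rewrite -[LHS]mul1mx -bose_mesner1 bose_mesner_horner Cayley_Hamilton mulmx0
             bose_mesner0.
suff -> : \prod_(i < D.+1) ('X - (theta i)%:P) = char_poly L by [].
have := @all_roots_prod_XsubC _ (char_poly L) [seq theta i | i <- iota 0 D.+1].
rewrite (eqP (char_poly_monic L)) scale1r big_map size_char_poly size_map size_iota.
rewrite -[iota 0 D.+1]/(index_iota 0 D.+1) big_mkord => -> //.
  apply/allP => x /mapP[i]; rewrite mem_iota add0n => /= iD ->.
  have /eigenvalueP[v vA v0] := theta_eig _ iD.
  have Av : A *m v^T = theta i *: v^T by rewrite -{1}adjmx_sym -trmx_mul vA linearZ.
  have := horner_mx_eigen _ _ _ _ _ _ (char_poly L) Av.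
  rewrite LA mul0mx => /esym/eqP; rewrite scaler_eq0 => /orP[//|].
  by rewrite trmx_eq0 (negPf v0).
rewrite uniq_rootsE map_inj_in_uniq ?iota_uniq // => i j.
rewrite !mem_iota !add0n /= !ltnS => iD jD; apply: contra_eq.
exact: theta_neq theta_dec _ _ iD jD.
Qed.

End Spectrum.

End BoseMesner.

(** * Entrywise squares of projections *)

Section OrthogonalProjection.
Context (R : realType) (n : nat) (E : 'M[R]_n).
Hypotheses (E_tr : E^T = E) (E_idem : E *m E = E).

(** Symmetry and idempotence make [E] the Gram matrix of its own rows. *)
Lemma orth_proj_entry x y : E x y = \sum_z E x z * E y z.
Proof.
by rewrite -[in LHS]E_idem mxE; apply: eq_bigr => z _; rewrite -[in E z y]E_tr mxE.
Qed.

Lemma orth_proj_diag_ge0 x : 0 <= E x x.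
Proof. by rewrite orth_proj_entry sumr_ge0 // => z _; rewrite -expr2 sqr_ge0. Qed.

Lemma orth_proj_entry_le x y : E x y *+ 2 <= E x x + E y y.
Proof.
have : 0 <= \sum_z (E x z - E y z) ^+ 2 by apply: sumr_ge0 => z _; apply: sqr_ge0.
rewrite (eq_bigr (fun z => E x z * E x z + E y z * E y z - (E x z * E y z) *+ 2)).
  by rewrite !big_split /= sumrN sumrMnl -!orth_proj_entry subr_ge0.
by move=> z _; ring.
Qed.

Lemma sqnorm_ge0 m (v : 'cV[R]_m) : 0 <= (v^T *m v) 0 0.
Proof. by rewrite mxE sumr_ge0 // => z _; rewrite mxE -expr2 sqr_ge0. Qed.

Lemma orth_proj_form (f : 'cV[R]_n) : (f^T *m E *m f) = (E *m f)^T *m (E *m f).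
Proof. by rewrite trmx_mul E_tr mulmxA -[in RHS](mulmxA f^T) E_idem. Qed.

(* The Schur product theorem for E o E, with an explicit sum of squares that also
   identifies its kernel. *)
Lemma hadamard_sqr_ker (f : 'cV[R]_n) :
  (f^T *m hadamard E E *m f) 0 0 = 0 -> hadamard E E *m f = 0.
Proof.
(* [G] is [E diag(f) E]; the quadratic form turns out to be its squared Frobenius norm, and
   [hadamard E E *m f] is linear in its entries. *)
pose G z w := \sum_y f y 0 * E y z * E y w.
have Mf x : (hadamard E E *m f) x 0 = \sum_z \sum_w E x z * E x w * G z w.
  rewrite mxE /G.
  under [RHS]eq_bigr do under eq_bigr do rewrite mulr_sumr.
  under [RHS]eq_bigr do rewrite exchange_big.
  rewrite exchange_big; apply: eq_bigr => y _; rewrite mxE.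
  rewrite {1 2}(orth_proj_entry x y) big_distrlr /= mulr_suml.
  by apply: eq_bigr => z _; rewrite mulr_suml; apply: eq_bigr => w _; ring.
have fMf : (f^T *m hadamard E E *m f) 0 0 = \sum_z \sum_w G z w ^+ 2.
  rewrite -mulmxA mxE; under eq_bigr do rewrite Mf mulr_sumr.
  rewrite exchange_big; apply: eq_bigr => z _ /=.
  under eq_bigr do rewrite mulr_sumr.
  rewrite exchange_big; apply: eq_bigr => w _ /=.
  rewrite expr2 {2}/G mulr_suml; apply: eq_bigr => x _; rewrite !mxE; ring.
rewrite fMf => /psumr_eq0P G0; apply/colP => x; rewrite Mf mxE.
rewrite big1 // => z _; rewrite big1 // => w _.
have /psumr_eq0P/(_ w isT) : \sum_w G z w ^+ 2 = 0.
  by apply: G0 => // z' _; apply: sumr_ge0 => w' _; apply: sqr_ge0.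
move=> Gzw; apply/eqP; rewrite mulf_eq0 -[G z w == 0]sqrf_eq0.
by rewrite Gzw ?eqxx ?orbT // => w' _; apply: sqr_ge0.
Qed.

End OrthogonalProjection.

(** * Entries of eigenmatrices at distances 0, 1 and 2 *)

Section SmallDistances.
Context (R : realType) (n : nat) (adj : rel 'I_n.+1) (D : nat) (b c : nat -> nat).
Hypotheses (drg : is_drg adj D b c) (D2 : (2 <= D)%N).
Notation A := (adjmx R adj).

Lemma drg_b0E : (b 0 = b 1 + (a_ b c 1).+1)%N.
Proof.
have := drg_bc_le _ _ _ _ _ drg 1; rewrite /a_ (drg_c1 _ _ _ _ _ drg) //; lia.
Qed.

(** These are columns 0 and 1 of the recurrence; [D2] makes [inord 1] and [inord 2] genuine
    indices. *)
Lemma bose_mesner_eigen_small m x :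
  bose_mesner R n adj D m *m A = x *: bose_mesner R n adj D m ->
  (b 0)%:R * m 0 (inord 1) = x * m 0 0 /\
  m 0 0 + (a_ b c 1)%:R * m 0 (inord 1) + (b 1)%:R * m 0 (inord 2) = x * m 0 (inord 1).
Proof.
move=> /(bose_mesner_eigen _ _ _ _ _ _ drg) mA.
have c1 : c 1 = 1%N by rewrite (drg_c1 _ _ _ _ _ drg) // ltnW.
case: D D2 drg m mA => [|[|D']] // _ _ m mA.
have i1 : inord 1 = lift ord0 ord0 :> 'I_D'.+3 by apply: val_inj; rewrite /= inordK.
have i2 : inord 2 = lift ord0 (lift ord0 ord0) :> 'I_D'.+3.
  by apply: val_inj; rewrite /= inordK.
rewrite i1 i2; split.
  rewrite -mA !big_ord_recl big1 => [|i _].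
    by rewrite /intersection_number /= subnn sub0n; ring.
  by rewrite /intersection_number /= mulr0.
rewrite -mA !big_ord_recl big1 => [|i _].
  by rewrite /intersection_number /= c1 /a_ c1; ring.
by rewrite /intersection_number /= mulr0.
Qed.

(* The value of an eigenmatrix of the Bose-Mesner algebra on the vector of GQ_vector,
   for a quadrangle of order (s, s^2) with s = a_1 + 1. *)
Lemma quadrangle_form m x (s : R) : s = (a_ b c 1).+1%:R ->
  bose_mesner R n adj D m *m A = x *: bose_mesner R n adj D m ->
  (m 0 0 - m 0 (inord 2) - (s ^+ 2 + 1) * (m 0 (inord 1) - m 0 (inord 2))) *
    ((b 0)%:R * (b 1)%:R) =
  m 0 0 * ((x - (b 0)%:R) * (s ^+ 2 * x - ((b 0)%:R - s * (s + 1)))).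
Proof.
move=> sE /bose_mesner_eigen_small[].
have b0E : (b 0)%:R = (b 1)%:R + s :> R by rewrite drg_b0E natrD -sE.
have aE : (a_ b c 1)%:R = s - 1 by rewrite sE -natr1 addrK.
rewrite aE; move: (m 0 0) (m 0 (inord 1)) (m 0 (inord 2)) => m0 m1 m2 e1 e2.
have -> : (b 1)%:R = (b 0)%:R - s by rewrite b0E addrK.
have {}e2 : ((b 0)%:R - s) * m2 = x * m1 - m0 - (s - 1) * m1.
  by rewrite -e2 b0E; ring.
(* The terms are grouped so that [m2] and then [m1] occur only through the left sides of [e2] and
   [e1], which avoids division. *)
transitivity ((b 0)%:R * ((b 0)%:R - s) * m0 - (s ^+ 2 + 1) * ((b 0)%:R - s) * ((b 0)%:R * m1)
   + s ^+ 2 * (b 0)%:R * (((b 0)%:R - s) * m2)); first by ring.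
rewrite e2.
transitivity ((b 0)%:R * ((b 0)%:R - s) * m0 - (s ^+ 2 + 1) * ((b 0)%:R - s) * ((b 0)%:R * m1)
   + s ^+ 2 * ((x - (s - 1)) * ((b 0)%:R * m1) - (b 0)%:R * m0)); first by ring.
rewrite e1; ring.
Qed.

End SmallDistances.

(** * The second largest eigenvalue and the decomposition of the entrywise square *)

Theorem theorem3p3 (R : realType) (n : nat) (adj : rel 'I_n)
    (D : nat) (b c : nat -> nat) (theta : nat -> R) (E : nat -> 'M[R]_n) :
  is_drg adj D b c ->
  (3 <= b 0)%N -> (2 <= D)%N -> a_ b c 1 <> 0%N ->
  (forall i j, (i < j <= D)%N -> theta j < theta i) ->
  (forall x : R, eigenvalue (adjmx R adj) x <-> exists2 i, (i <= D)%N & x = theta i) ->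
  theta D = - (b 0%N)%:R / (a_ b c 1).+1%:R ->
  (forall i, (i <= D)%N -> is_orth_proj (E i) (eigenspace (adjmx R adj) (theta i))) ->
  c 2%N = ((a_ b c 1).+1 ^ 2).+1 ->
  (exists S : {set 'I_n}, is_GQ (induced adj S) (a_ b c 1).+1 (c 2%N).-1) ->
  theta 1%N = ((b 0%N)%:R - ((a_ b c 1).+1 * (a_ b c 1).+2)%:R) / ((a_ b c 1).+1 ^ 2)%:R
  /\ light_tail_with (E D) (E 1%N) (E 0%N).
Proof.
move=> drg _ D2 a1_neq0 theta_dec eig thetaD proj c2 [S gq].
have [x0 _] := drg_ex_dist _ _ _ _ _ drg _ (leq0n D).
(* The vertex [x0] excludes the empty graph, so the matrices form a ring. *)
case: n => [|n] in adj E drg eig proj S gq x0 *; first by case: x0.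
set A := adjmx R adj in eig proj *.
have A_sym := adjmx_sym R _ _ _ _ _ drg.
have conn := drg_conn _ _ _ _ _ drg; have irr := drg_irr _ _ _ _ _ drg.
have theta_eig i : (i <= D)%N -> eigenvalue A (theta i) by move=> iD; apply/eig; exists i.
have A_min := adjmx_annihilated _ _ _ _ _ _ drg _ theta_dec theta_eig.
pose BM := bose_mesner R n adj D.
have [s sE] : exists s : R, s = (a_ b c 1).+1%:R by eexists.
set k : R := (b 0%N)%:R in thetaD *; rewrite -sE in thetaD.
have s_gt1 : 1 < s by rewrite sE ltr1n; case: (a_ b c 1) a1_neq0.
have s_gt0 : 0 < s by apply: lt_trans s_gt1.
have s_neq0 := lt0r_neq0 s_gt0.
have s2_gt1 : 1 < s ^+ 2 by rewrite exprn_egt1.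
have b1_gt0 : 0 < (b 1%N)%:R :> R by rewrite ltr0n (drg_b_gt0 _ _ _ _ _ drg).
have k_gt0 : 0 < k by rewrite ltr0n (drg_b_gt0 _ _ _ _ _ drg) // ltnW.
have kE : k = (b 1%N)%:R + s by rewrite /k (drg_b0E _ _ _ _ _ drg D2) natrD -sE.
pose theta' := (k - s * (s + 1)) / s ^+ 2.
have -> : (k - ((a_ b c 1).+1 * (a_ b c 1).+2)%:R) / ((a_ b c 1).+1 ^ 2)%:R = theta'.
  by rewrite natrM natrX -[(a_ b c 1).+2]addn1 natrD -sE.
have s2_gt0 : 0 < s ^+ 2 by apply: lt_trans s2_gt1.
have BM_adj i m : (i <= D)%N -> E i = BM m -> BM m *m A = theta i *: BM m.
  by move=> iD <-; apply: proj_mulA proj _ iD.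
have BM_diag m x : BM m x x = m 0 0.
  rewrite (bose_mesnerE _ _ _ _ _ _ _ 0) ?dist_xx //.
  by congr (m 0 _); apply: val_inj; rewrite /= inordK.
have E_neq0 i : (i <= D)%N -> E i != 0.
  move=> iD; have [_ [_ /andP[_ leE]]] := proj i iD; have := theta_eig i iD.
  by apply: contraNneq => E0; move: leE; rewrite E0 submx0.
(* [m 0 0] is the constant diagonal of [E i]: it is nonnegative, and were it zero the recurrence
   would make [E i] vanish. *)
have E_BM i : (i <= D)%N -> exists2 m, E i = BM m & 0 < m 0 0.
  move=> iD; have [p Ep] := proj_horner _ _ _ _ _ _ A_sym theta_dec proj A_min _ iD.
  have [m Em] := horner_adjmx R _ _ _ _ _ drg p; rewrite -Ep -/(BM m) in Em; exists m => //.
  have [Et [EE _]] := proj i iD.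
  rewrite lt_neqAle -(BM_diag m x0) -Em orth_proj_diag_ge0 // andbT eq_sym Em BM_diag.
  apply: contraNneq (E_neq0 i iD) => m0.
  rewrite Em (bose_mesner_eigen0 _ _ _ _ _ _ drg m (theta i)) //; last exact: BM_adj.
  by rewrite [BM _]bose_mesner0.
have [f f_gt0 fM] := GQ_vector R _ _ conn irr _ _ _ (ltn0Sn _) gq.
pose Q (m : 'rV[R]_D.+1) :=
  m 0 0 - m 0 (inord 2) - (s ^+ 2 + 1) * (m 0 (inord 1) - m 0 (inord 2)).
have fBM m : (f^T *m BM m *m f) 0 0 = Q m * (f^T *m f) 0 0.
  rewrite (fM _ (m 0 0) (m 0 (inord 1)) (m 0 (inord 2))) //.
  - by rewrite c2 -natr1 natrX -sE.
  - by move=> x y; apply: bose_mesnerE.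
  - by move=> x y; apply: bose_mesnerE.
have Q_proj i m : (i <= D)%N -> E i = BM m ->
    Q m * (k * (b 1%N)%:R) = m 0 0 * (s ^+ 2 * ((theta i - k) * (theta i - theta'))).
  move=> iD Em; have := BM_adj i m iD Em.
  move/(quadrangle_form _ _ _ _ _ _ drg D2 _ _ s sE) => ->.
  rewrite /theta'; congr (_ * _); by field.
have BM_small i m : (i <= D)%N -> E i = BM m ->
    k * m 0 (inord 1) = theta i * m 0 0 /\
    m 0 0 + (s - 1) * m 0 (inord 1) + (b 1%N)%:R * m 0 (inord 2) =
      theta i * m 0 (inord 1).
  move=> iD Em; have := BM_adj i m iD Em.
  move/(bose_mesner_eigen_small _ _ _ _ _ _ drg D2) => [-> <-].
  by rewrite sE -natr1 addrK.
(* For adjacent [x], [y] the Gram bound says [m 0 (inord 1) <= m 0 0], while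
   [k * m 0 (inord 1) = theta i * m 0 0]. *)
have theta_le i : (i <= D)%N -> theta i <= k.
  move=> iD; have [m Em m_gt0] := E_BM i iD.
  have [Et [EE _]] := proj i iD; have [m1E _] := BM_small i m iD Em.
  have [x [y dxy]] := drg_ex_dist _ _ _ _ _ drg _ (ltnW D2).
  have := orth_proj_entry_le _ _ _ Et EE x y.
  rewrite Em !BM_diag (bose_mesnerE _ _ _ _ _ _ _ 1) // -mulr2n lerMn2r /=.
  by rewrite -(ler_pM2l k_gt0) m1E (ler_pM2r m_gt0).
have fEf i : (i <= D)%N -> (f^T *m E i *m f) 0 0 = ((E i *m f)^T *m (E i *m f)) 0 0.
  by move=> iD; have [Et [EE _]] := proj i iD; rewrite orth_proj_form.
have theta_quad i : (i <= D)%N -> 0 <= (theta i - k) * (theta i - theta').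
  move=> iD; have [m Em m_gt0] := E_BM i iD.
  rewrite -(pmulr_rge0 _ s2_gt0) -(pmulr_rge0 _ m_gt0) -(Q_proj i) //.
  rewrite pmulr_lge0; last exact: mulr_gt0.
  by rewrite -(pmulr_lge0 _ f_gt0) -fBM -Em fEf // sqnorm_ge0.
have theta_ker i : (i <= D)%N -> E i *m f = 0 -> theta i != k -> theta i = theta'.
  move=> iD Ef ne_k; have [m Em m_gt0] := E_BM i iD.
  have Q0 : Q m = 0.
    apply/eqP; rewrite -(mulIr_eq0 _ (mulIf (lt0r_neq0 f_gt0))) -fBM -Em fEf // Ef.
    by rewrite mulmx0 mxE.
  have /esym/eqP := Q_proj i m iD Em.
  rewrite Q0 mul0r mulf_eq0 (gt_eqF m_gt0) mulf_eq0 (gt_eqF s2_gt0) mulf_eq0 /=.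
  by rewrite !subr_eq0 (negPf ne_k) => /eqP.
pose one : 'rV[R]_n.+1 := const_mx 1.
have oneA : one *m A = k *: one.
  apply/rowP => y; rewrite !mxE mulr1 /k -(drg_valency _ _ _ _ _ drg y) -sum1_card natr_sum.
  rewrite [RHS]big_mkcond; apply: eq_bigr => z _; rewrite !mxE inE mul1r.
  by rewrite (drg_sym _ _ _ _ _ drg) /=; case: ifP.
(* The constants make [k] an eigenvalue, and no eigenvalue exceeds it. *)
have theta0 : theta 0%N = k.
  apply/le_anti; rewrite theta_le //=.
  have [|i iD ->] := (eig k).1.
    apply/eigenvalueP; exists one => //.
    by apply/eqP=> /rowP/(_ 0); rewrite !mxE => /eqP; rewrite oner_eq0.
  by case: i iD => // i iD; rewrite ltW // theta_dec.
have theta_lt i : (0 < i <= D)%N -> theta i < k.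
  by move=> /theta_dec; rewrite theta0.
set M := hadamard (E D) (E D).
have [d Ed d_gt0] := E_BM D (leqnn D).
have [d1E d2E] := BM_small D d (leqnn D) Ed.
(* With [theta D = - k / s], the entries of [E D] at distances 0, 1, 2 are proportional to [1],
   [- 1 / s], [1 / s ^+ 2]. *)
have d1 : d 0 (inord 1) = - d 0 0 / s.
  apply: (mulfI (lt0r_neq0 k_gt0)); rewrite d1E thetaD; by field.
have d2 : d 0 (inord 2) = d 0 0 / s ^+ 2.
  apply: (mulfI (lt0r_neq0 b1_gt0)).
  transitivity (theta D * d 0 (inord 1) - d 0 0 - (s - 1) * d 0 (inord 1)).
    by rewrite -d2E; ring.
  rewrite d1 thetaD kE; by field.
have [dd Mdd [dd0 dd1 dd2]] : exists2 dd, M = BM dd &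
    [/\ dd 0 0 = d 0 0 ^+ 2, dd 0 (inord 1) = d 0 0 ^+ 2 / s ^+ 2
      & dd 0 (inord 2) = d 0 0 ^+ 2 / s ^+ 4].
  exists (\row_i (d 0 i * d 0 i)); first by rewrite /M Ed bose_mesner_hadamard.
  by rewrite !mxE d1 d2; split; by field.
have M_sym : M^T = M.
  by apply/matrixP => x y; rewrite !mxE -[in E D y x](proj_tr _ _ _ _ _ _ proj _ (leqnn D)) mxE.
have Mf : M *m f = 0.
  have [Et [EE _]] := proj D (leqnn D); apply: hadamard_sqr_ker => //.
  rewrite -/M Mdd fBM /Q dd0 dd1 dd2.
  suff -> : forall e : R, e - e / s ^+ 4 - (s ^+ 2 + 1) * (e / s ^+ 2 - e / s ^+ 4) = 0.
    by rewrite mul0r.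
  by move=> e; by field.
(* [M *m E i] is an eigenmatrix for [theta i]; subtracting the multiple of [E i] with the same
   diagonal leaves zero. *)
have M_E i : (i <= D)%N -> exists q, M *m E i = q *: E i.
  move=> iD; have [p Ep] := proj_horner _ _ _ _ _ _ A_sym theta_dec proj A_min _ iD.
  have [m Em m_gt0] := E_BM i iD.
  set m' := dd *m horner_mx (intersection_mx R D b c) p.
  have Mm' : M *m E i = BM m' by rewrite Mdd Ep (bose_mesner_horner _ _ _ _ _ _ drg).
  exists (m' 0 0 / m 0 0).
  set w := m' - (m' 0 0 / m 0 0) *: m.
  have BMw : BM w = M *m E i - (m' 0 0 / m 0 0) *: E i.
    by rewrite /BM /w bose_mesnerD -scaleN1r !bose_mesnerZ -!/(BM _) -Mm' -Em scaleN1r.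
  have w0 : w = 0.
    apply: (bose_mesner_eigen0 _ _ _ _ _ _ drg _ (theta i)).
      rewrite -/(BM w) BMw mulmxBl -mulmxA -scalemxAl (proj_mulA _ _ _ _ _ _ proj) //.
      by rewrite -scalemxAr scalerBr !scalerA mulrC.
    by rewrite !mxE divfK ?subrr // lt0r_neq0.
  by apply/eqP; rewrite -subr_eq0 -BMw w0 [BM _]bose_mesner0.
(* Here [E i *m f] is nonzero, yet [q *: (E i *m f) = E i *m M *m f = 0], so [q = 0]. *)
have M_E0 i : (0 < i <= D)%N -> theta i != theta' -> M *m E i = 0.
  move=> iD ne_i; have [i0 iD'] := andP iD; have [q Mq] := M_E i iD'.
  have EiT := proj_tr _ _ _ _ _ _ proj _ iD'.
  have EM : E i *m M = q *: E i by rewrite -{1}EiT -M_sym -trmx_mul Mq linearZ /= EiT.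
  have : q *: (E i *m f) = 0 by rewrite scalemxAl -EM -mulmxA Mf mulmx0.
  move/eqP; rewrite scaler_eq0 => /orP[/eqP q0|/eqP Ef]; first by rewrite Mq q0 scale0r.
  by rewrite (theta_ker i) ?eqxx // in ne_i; rewrite lt_eqF // theta_lt.
have M_sep (W : 'M[R]_n.+1) : (forall i, (i <= D)%N -> W *m E i = 0) -> W = 0.
  exact: (proj_separate _ _ _ _ _ _ A_sym proj A_min).
have ortho i j : (i <= D)%N -> (j <= D)%N -> i != j -> E i *m E j = 0.
  exact: (proj_ortho _ _ _ _ _ _ A_sym theta_dec proj).
have idem i : (i <= D)%N -> E i *m E i = E i by apply: (proj_idem _ _ _ _ _ _ proj).
have [q0 Mq0] := M_E 0%N isT.
(* Otherwise [M] is a multiple of [E 0], whose entries at distances 0 and 1 agree by the recurrence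
   at [theta 0 = k]; those of [M] differ by the factor [s ^+ 2 > 1]. *)
have [l /andP[l_gt0 Ml]] : exists l : 'I_D.+1, (0 < l)%N && (M *m E l != 0).
  apply/existsP; apply: contraT => /existsPn M0.
  have Mq : M = q0 *: E 0%N.
    apply/eqP; rewrite -subr_eq0; apply/eqP/M_sep => -[_|i iD].
      by rewrite mulmxBl -scalemxAl idem // Mq0 subrr.
    have := M0 (Ordinal (iD : (i.+1 < D.+1)%N)); rewrite /= negbK => /eqP Mi.
    by rewrite mulmxBl -scalemxAl ortho // Mi scaler0 subrr.
  have [e Ee e_gt0] := E_BM 0%N isT; have [e1 _] := BM_small 0%N e isT Ee.
  rewrite theta0 in e1; have {}e1 := mulfI (lt0r_neq0 k_gt0) e1.
  have [x [y dxy]] := drg_ex_dist _ _ _ _ _ drg _ (ltnW D2).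
  have Mxy : M x x = M x y.
    by rewrite Mq Ee !mxE dist_xx dxy e1; congr (_ * e 0 _); apply: val_inj; rewrite /= inordK.
  move: Mxy; rewrite Mdd BM_diag (bose_mesnerE _ _ _ _ _ _ _ 1) // dd0 dd1 => /eqP.
  rewrite -[X in X == _]mulr1 (inj_eq (mulfI _)) ?expf_neq0 ?lt0r_neq0 //.
  by rewrite gt_eqF // invf_lt1.
have l_le : (l <= D)%N by rewrite -ltnS.
have theta_l : theta l = theta'.
  by apply/eqP; apply: contraNT Ml => /M_E0 -> //; rewrite l_gt0.
(* [theta_quad] gives one inequality; the other holds because [theta'] is some [theta l] with
   [l > 0]. *)
have theta1 : theta 1%N = theta'.
  apply/le_anti/andP; split.
    have := theta_quad 1%N (ltnW D2).
    by rewrite nmulr_rge0 ?subr_le0 // subr_lt0 theta_lt //= ltnW.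
  rewrite -theta_l; have [->//|ne_l1] := eqVneq (l : nat) 1%N.
  by rewrite ltW // theta_dec // l_le andbT ltn_neqAle eq_sym ne_l1.
have l1 : l = 1%N :> nat.
  apply/eqP; apply: contraT => /(theta_neq _ _ _ theta_dec _ _ l_le (ltnW D2)).
  by rewrite theta_l theta1 eqxx.
have [q1 Mq1] := M_E 1%N (ltnW D2).
split=> //; split.
  apply: contraNneq (E_neq0 1%N (ltnW D2)) => E10.
  by rewrite -(idem _ (ltnW D2)) {1}E10 ortho // ltnW.
exists q0, q1; split; last split.
(* If [q0 = 0], then [M] kills the all-ones vector; its entries being squares, row [x0] would
   vanish, against the positive diagonal. *)
- apply/eqP => q00; rewrite q00 scale0r in Mq0.
  have one0 : one *m E 0%N = one by apply: (proj_fix _ _ _ _ _ _ proj); rewrite ?theta0.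
  have : M *m one^T = 0.
    rewrite -one0 trmx_mul (proj_tr _ _ _ _ _ _ proj) // mulmxA Mq0.
    exact: mul0mx.
  move/colP/(_ x0); rewrite !mxE => /psumr_eq0P/(_ x0 isT) => Mx0.
  have : M x0 x0 = 0.
    rewrite -[LHS]mulr1 -[1](_ : one^T x0 0 = 1) ?Mx0 ?mxE // => y _.
    by rewrite !mxE mulr1 -expr2 sqr_ge0.
  by move/eqP; rewrite Mdd BM_diag dd0 sqrf_eq0 gt_eqF.
- by apply: contraNneq Ml => q10; rewrite l1 Mq1 q10 scale0r.
(* The identity is tested against each [E i]; for [i >= 2] both sides vanish since
   [theta i < theta 1 = theta']. *)
apply/eqP; rewrite -subr_eq0; apply/eqP/M_sep => i iD.
rewrite mulmxBl mulmxDl -!scalemxAl; case: i iD => [|[|i]] iD.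
- by rewrite idem // ortho // ?scaler0 ?addr0 ?Mq0 ?subrr // ltnW.
- by rewrite idem // ortho // scaler0 add0r Mq1 subrr.
- rewrite !ortho // ?(ltnW D2) // !scaler0 addr0 subr0 M_E0 //.
  by rewrite -theta1 lt_eqF // theta_dec.
Qed.
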